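(* Let $\mathfrak g$ be a complex simple Lie algebra of rank at least 2, $\mathfrak h$ a Cartan subalgebra with root system $\Delta$, positive roots $\Delta^+$, simple roots $\Pi$ and longest root $\eta$. Let $Z^\dagger=\Pi\cup\{-\eta\}$, $Z=\{\alpha\in\Delta\mid-\alpha\in Z^\dagger\}$, and $$\mathfrak g_Z=\bigoplus_{\alpha\in Z}\mathfrak g_\alpha,\quad \mathfrak g_{Z^\dagger}=\bigoplus_{\alpha\in Z^\dagger}\mathfrak g_\alpha,\quad \mathfrak g_1=\bigoplus_{\alpha\in\Delta\setminus(Z\cup Z^\dagger)}\mathfrak g_\alpha .$$ Then $$[\mathfrak h,\mathfrak g_{Z^\dagger}]\subset\mathfrak g_{Z^\dagger},\quad[\mathfrak h,\mathfrak g_Z]\subset\mathfrak g_Z,\quad[\mathfrak h,\mathfrak g_1]\subset\mathfrak g_1,\quad[\mathfrak g_Z,\mathfrak g_{Z^\dagger}]\subset\mathfrak h,$$ $$[\mathfrak g_{Z^\dagger},\mathfrak g_1]\subset\mathfrak g_1\oplus\mathfrak g_Z,\quad[\mathfrak g_Z,\mathfrak g_1]\subset\mathfrak g_1\oplus\mathfrak g_{Z^\dagger},$$ $$[\mathfrak g_Z,\mathfrak g_Z]\subset\mathfrak g_1\oplus\mathfrak g_{Z^\dagger},\quad[\mathfrak g_{Z^\dagger},\mathfrak g_{Z^\dagger}]\subset\mathfrak g_1\oplus\mathfrak g_Z .$$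
   Context: $\mathfrak g_\alpha$ denotes the root space of $\alpha$. The longest root $\eta$ is the unique positive root such that $\beta+\eta$ is not a root for any positive root $\beta$ (the highest root). *)

(* Defs.v *)
From mathcomp Require Import all_boot all_order all_algebra.
From mathcomp Require Import all_classical all_reals.
From mathcomp Require Export complex.

Set Implicit Arguments.
Unset Strict Implicit.
Unset Printing Implicit Defensive.

Import GRing.Theory.
Local Open Scope ring_scope.
Local Open Scope classical_set_scope.

Section LieAlgebra.
Variables (K : fieldType) (g : vectType K) (br : {bilinear g -> g -> g}).

Definition lie_bracket : Prop :=
  (forall x, br x x = 0) /\
  (forall x y z, br x (br y z) + br y (br z x) + br z (br x y) = 0).

Definition lspan (A : set g) : set g :=
  [set x | exists s : seq (K * g),
     (forall p, p \in s -> A p.2) /\ x = \sum_(p <- s) p.1 *: p.2].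

Definition lie_set (A B : set g) : set g :=
  lspan [set br a b | a in A & b in B].

(* Only applied to sums of root spaces over disjoint sets of roots, for which the
   sum is automatically direct. *)
Definition sum_set (A B : set g) : set g := [set a + b | a in A & b in B].

Definition lie_ideal (I : {vspace g}) : Prop :=
  forall x y, y \in I -> br x y \in I.

Definition simple_lie : Prop :=
  (exists x y, br x y != 0) /\
  (forall I : {vspace g}, lie_ideal I -> I = 0%VS \/ I = fullv).

Definition lie_subalgebra (h : {vspace g}) : Prop :=
  forall x y, x \in h -> y \in h -> br x y \in h.

Fixpoint lower_central (h : {vspace g}) (n : nat) : set g :=
  if n is m.+1 then lie_set [set` h] (lower_central h m) else [set` h].

Definition nilpotent_lie (h : {vspace g}) : Prop :=
  exists n, lower_central h n `<=` [set 0].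

Definition self_normalizing (h : {vspace g}) : Prop :=
  forall x, (forall y, y \in h -> br x y \in h) -> x \in h.

(* The general definition, valid in any Lie algebra: nilpotent and
   self-normalizing. *)
Definition cartan_subalgebra (h : {vspace g}) : Prop :=
  [/\ lie_subalgebra h, nilpotent_lie h & self_normalizing h].

(* K^o is K viewed as a one-dimensional space over itself. *)
Definition dual (h : {vspace g}) := 'Hom(subvs_of h, K^o).

Section Roots.
Variable h : {vspace g}.

Definition root_space (alpha : dual h) : set g :=
  [set x | forall t : subvs_of h, br (vsval t) x = (alpha t : K) *: x].

Definition roots : set (dual h) :=
  [set alpha | alpha != 0 /\ exists2 x, x != 0 & root_space alpha x].

(* Choice of positive roots: the set of roots is the disjoint union of P and -P,
   and P is closed under those sums that are roots. *)
Definition positive_system (P : set (dual h)) : Prop :=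
  [/\ P `<=` roots,
      forall alpha, roots alpha -> P alpha \/ P (- alpha),
      forall alpha, ~ (P alpha /\ P (- alpha)) &
      forall alpha beta, P alpha -> P beta -> roots (alpha + beta) ->
        P (alpha + beta)].

Definition simple_roots (P : set (dual h)) : set (dual h) :=
  [set alpha | P alpha /\
     ~ exists beta gamma, [/\ P beta, P gamma & alpha = beta + gamma]].

Definition longest_root (P : set (dual h)) (eta : dual h) : Prop :=
  P eta /\ forall beta, P beta -> ~ roots (beta + eta).

Definition Zdag (P : set (dual h)) (eta : dual h) : set (dual h) :=
  simple_roots P `|` [set - eta].

Definition Zset (P : set (dual h)) (eta : dual h) : set (dual h) :=
  [set alpha | roots alpha /\ Zdag P eta (- alpha)].

(* The sum of the root spaces over S; root spaces of distinct roots are linearly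
   independent, so it is automatically direct. *)
Definition root_sum (S : set (dual h)) : set g :=
  lspan (\bigcup_(alpha in S) root_space alpha).

Definition g_Zdag P eta := root_sum (Zdag P eta).
Definition g_Z P eta := root_sum (Zset P eta).
Definition g_1 P eta := root_sum (roots `\` (Zset P eta `|` Zdag P eta)).

End Roots.
End LieAlgebra.

(* Main.v *)
(* By [g_alpha, g_beta] <= g_(alpha + beta), the inclusions are statements about sums of
   two roots. Their failure contradicts, by manipulations with positive roots, the
   indecomposability of simple roots or the maximality of eta, except when eta is
   itself simple and -eta is a root; only there does the rank matter.

   In that case no root other than eta, -eta can be shifted by eta, so the elements
   commuting with all other root spaces form a nonzero ideal; by simplicity the only
   roots are eta and -eta. Then tr((ad s)^2) is a positive natural multiple of
   eta(s)^2 for s in h. If dim h >= 2, some nonzero z in h has eta(z) = 0; z is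
   orthogonal to everything for the Killing form, whose radical is an ideal, so the
   form is zero, contradicting tr((ad t)^2) <> 0 when eta(t) <> 0.

   Neither the commutativity of h nor the semisimplicity of its action is used: root
   spaces are replaced by generalized weight spaces, which span g, have root weights by
   Lie's theorem for the nilpotent algebra h, and reduce to h for the weight 0. *)
From HB Require Import structures.
Require Import Defs.
From mathcomp Require Import all_boot all_order all_algebra.
From mathcomp Require Import all_classical all_reals.
From mathcomp Require Import ring.

Set Implicit Arguments.
Unset Strict Implicit.
Unset Printing Implicit Defensive.

Import GRing.Theory Num.Theory VectorInternalTheory.
Local Open Scope ring_scope.
Local Open Scope classical_set_scope.
Local Open Scope complex_scope.

Lemma vspace_of_pred (K : fieldType) (V : vectType K) (P : V -> Prop) :
    P 0 -> (forall a x y, P x -> P y -> P (a *: x + y)) ->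
  exists U : {vspace V}, forall x, x \in U <-> P x.
Proof.
move=> P0 PL.
suff ext k (U : {vspace V}) : (forall x, x \in U -> P x) ->
    (dim V <= \dim U + k)%N ->
    exists U' : {vspace V}, forall x, x \in U' <-> P x.
  apply: (ext (dim V) 0%VS) => [x|]; first by rewrite memv0 => /eqP ->.
  by rewrite leq_addl.
elim: k U => [|k IHk] U UP dimU.
  exists U => x; split=> [/UP //|_].
  suff -> : U = fullv by rewrite memvf.
  by apply/eqP; rewrite eqEdim subvf dimvf -[\dim U]addn0.
have [[x Px nUx]|noext] := pselect (exists2 x, P x & x \notin U); last first.
  exists U => x; split=> [/UP //|Px]; apply: contrapT => /negP nUx.
  by apply: noext; exists x.
apply: (IHk (<[x]> + U)%VS) => [y|].
  by case/memv_addP=> _ /vlineP[c ->] [u Uu ->]; apply: PL => //; exact: UP.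
suff : (\dim U < \dim (<[x]> + U))%N.
  by move=> ltU; rewrite (leq_trans dimU) // addnS -addSn leq_add2r.
rewrite (ltn_leqif (dimv_leqif_sup (addvSr _ _))).
apply: contra nUx => /subvP; apply; apply: (subvP (addvSl _ _)).
exact: memv_line.
Qed.

Lemma mx_annihilator (K : closedFieldType) n (A : 'M[K]_n) :
  exists rs : seq K, forall v : 'rV_n,
    foldr (fun a u => u *m A - a *: u) v rs = 0.
Proof.
case: n A => [|n] A; first by exists [::] => v /=; rewrite thinmx0.
have [rs rsE] := closed_field_poly_normal (char_poly A).
exists rs => v.
have: v *m horner_mx A (char_poly A) = 0 by rewrite Cayley_Hamilton mulmx0.
rewrite rsE (monicP (char_poly_monic A)) scale1r => <-.
elim: rs {rsE} => [|a rs IHrs] /=; first by rewrite big_nil rmorph1 mulmx1.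
rewrite big_cons mulrC rmorphM /= mulmxA -IHrs.
by rewrite rmorphB /= horner_mx_X horner_mx_C mulmxBr mul_mx_scalar.
Qed.

Lemma lfun_annihilator (K : closedFieldType) (V : vectType K)
    (f : {linear V -> V}) :
  exists rs : seq K, forall v, foldr (fun a u => f u - a *: u) v rs = 0.
Proof.
have [rs rs0] := mx_annihilator (lin1_mx (v2r \o f \o r2v)).
exists rs => v; apply: (can_inj (v2rK)); rewrite linear0 -(rs0 (v2r v)).
elim: rs {rs0} => //= a rs IHrs.
by rewrite -IHrs mul_rV_lin1 /= v2rK linearB linearZ.
Qed.

Lemma mxtrace_eigenvalues (K : closedFieldType) n (A : 'M[K]_n) :
  exists2 rs : seq K, \tr A = \sum_(r <- rs) r & rs =i eigenvalue A.
Proof.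
have [rs rsE] := closed_field_poly_normal (char_poly A).
move: rsE; rewrite (monicP (char_poly_monic A)) scale1r => rsE.
exists rs; last first.
  by move=> a; rewrite -root_prod_XsubC -rsE -eigenvalue_root_char.
have szrs : size rs = n.
  by apply: succn_inj; rewrite -(size_char_poly A) rsE size_prod_XsubC.
have [n0|n_gt0] := posnP n.
  have -> : rs = [::] by apply: size0nil; rewrite szrs.
  by rewrite big_nil; apply: big1 => i _; have := ltn_ord i; rewrite [X in (_ < X)%N]n0.
apply: oppr_inj; rewrite -coefPn_prod_XsubC -?lt0n ?szrs //.
by rewrite -rsE char_poly_trace.
Qed.


Section HighestRoot.
Variables (V : zmodType) (R P : set V) (eta : V).

(* Convertible to [simple_roots] when [V] is [dual h]. *)
Definition indecomposable (P : set V) a :=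
  P a /\ ~ exists b c, [/\ P b, P c & a = b + c].

Hypotheses (R0 : ~ R 0) (PR : P `<=` R).
Hypothesis RP : forall a, R a -> P a \/ P (- a).
Hypothesis PN : forall a, ~ (P a /\ P (- a)).
Hypothesis PD : forall a b, P a -> P b -> R (a + b) -> P (a + b).
Hypotheses (Peta : P eta) (eta_max : forall a, P a -> ~ R (a + eta)).
Hypothesis eta_dec : R (- eta) -> ~ indecomposable P eta.

Local Notation Zd := (indecomposable P `|` [set - eta]).

Lemma extended_simple_sub a b : Zd a -> Zd b -> R a \/ R (- b) -> ~ R (a - b).
Proof.
case=> [[Pa ina]|->] [[Pb inb]|->] Rab Rs.
- case: (RP Rs) => Ps.
    by apply: ina; exists b, (a - b); split=> //; rewrite addrC subrK.
  by apply: inb; exists a, (- (a - b)); split=> //; rewrite opprB addrC subrK.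
- by apply: (eta_max Pa); rewrite opprK in Rs.
- case: (RP Rs) => Ps; last first.
    by apply: (eta_max Pb); move: (PR Ps); rewrite opprB opprK.
  case: Rab => [Re|Rb].
    apply: (@PN eta); split=> //; rewrite -[- eta](subrK b).
    by apply: PD => //; rewrite subrK.
  apply: (@PN b); split=> //; rewrite -[- b](addNKr eta).
  by apply: PD => //; rewrite addNKr.
by apply: R0; rewrite -(subrr (- eta)).
Qed.

Lemma extended_simple_add_neq0 a b : Zd a -> Zd b ->
  (R a /\ R b) \/ (R (- a) /\ R (- b)) -> a + b != 0.
Proof.
move=> Za Zb Rab; apply/eqP => /eqP; rewrite addr_eq0 => /eqP abE.
case: Za => [ia|aE]; case: Zb => [ib|bE].
- by apply: (@PN b); split; [case: ib | rewrite -abE; case: ia].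
- move: abE; rewrite bE opprK => aE; rewrite aE bE in ia Rab.
  by apply: eta_dec ia; case: Rab => -[].
- have bE : b = eta by rewrite -[b]opprK -abE aE opprK.
  rewrite aE bE in ib Rab; by apply: eta_dec ib; case: Rab => -[].
by apply: (@PN eta); split=> //; move: abE; rewrite aE bE opprK => ->.
Qed.

Lemma extended_simple_add a b : Zd a -> Zd b ->
  [/\ R a, R b & R (a + b)] \/ [/\ R (- a), R (- b) & R (- (a + b))] ->
  ~ Zd (a + b).
Proof.
have mixed a' : P a' -> ~ Zd (a' - eta).
  move=> Pa [[Pc _]|cE]; first by apply: (eta_max Pc); rewrite subrK; apply: PR.
  apply: R0; suff <- : a' = 0 by apply: PR.
  by apply: (addIr (- eta)); rewrite cE add0r.
case=> [[Pa _]|->] [[Pb _]|->] Rab.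
- case=> [[_ inc]|cE]; first by apply: inc; exists a, b.
  case: Rab => [[_ _ Rc]|[_ Rb _]].
    by apply: (@PN eta); split=> //; rewrite -cE; apply: PD.
  by apply: (eta_max Pa); rewrite -[eta]opprK -cE opprD addNKr.
- exact: mixed.
- by rewrite addrC; apply: mixed.
case=> [[Pc _]|cE].
  case: Rab => [[Re _ _]|[_ _ Rc]]; first by apply: (eta_max Pc); rewrite subrK.
  by apply: (eta_max Peta); move: Rc; rewrite opprB opprK.
apply: R0; suff <- : - - eta = 0 by rewrite opprK; apply: PR.
by apply/eqP; rewrite oppr_eq0; apply/eqP/(addIr (- eta)); rewrite cE add0r.
Qed.
End HighestRoot.

Lemma v2rE (K : fieldType) (V : vectType K) :
  ((forall x y : V, (v2r (x + y) = v2r x + v2r y)%R) *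
   (forall x : V, (v2r (- x) = - v2r x)%R) *
   (forall c (x : V), (v2r (c *: x) = c *: v2r x)%R) * (v2r (0%R : V) = 0%R))%type.
Proof.
split; last exact: linear0.
split; last by move=> c x; exact: linearZ_LR.
by split=> [x y|x]; [exact: linearD | exact: linearN].
 Qed.

(* Taking coordinates reduces identities in [V] to [ring] identities in [K]. *)
Ltac vring :=
  apply: v2r_inj; apply/rowP => ?;
  rewrite ?v2rE ?mxE; ring.

Section LieTheory.
Variables (K : numClosedFieldType) (g : vectType K).
Variable br : {bilinear g -> g -> g}.
Hypothesis Hlie : lie_bracket br.

Lemma br_anti x y : br x y = - br y x.
Proof.
have [alt _] := Hlie; have := alt (x + y).
by rewrite linearDl !linearDr /= !alt add0r addr0 => /eqP; rewrite addr_eq0 => /eqP.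
Qed.

Lemma jacobi x y z : br x (br y z) = br (br x y) z + br y (br x z).
Proof.
have [_ jac] := Hlie; have := jac x y z.
rewrite (br_anti z x) (br_anti z (br x y)) linearNr => /eqP.
by rewrite -addrA -opprD subr_eq0 addrC => /eqP.
Qed.

Let brDl x y z : br (x + y) z = br x z + br y z. Proof. exact: linearDl. Qed.
Let brDr x y z : br z (x + y) = br z x + br z y. Proof. exact: linearDr. Qed.
Let brNl x z : br (- x) z = - br x z. Proof. exact: linearNl. Qed.
Let brNr x z : br z (- x) = - br z x. Proof. exact: linearNr. Qed.
Let brZl c x z : br (c *: x) z = c *: br x z. Proof. exact: linearZl_LR. Qed.
Let brZr c x z : br z (c *: x) = c *: br z x. Proof. exact: linearZr_LR. Qed.
Let br0l z : br 0 z = 0. Proof. exact: linear0l. Qed.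
Let br0r z : br z 0 = 0. Proof. exact: linear0r. Qed.
Let brE := (brDl, brDr, brNl, brNr, brZl, brZr, br0l, br0r).

Definition shift s a x := br s x - a *: x.
Definition gen_eigen s a x := exists n, iter n (shift s a) x = 0.

Lemma shiftP s a c x y : shift s a (c *: x + y) = c *: shift s a x + shift s a y.
Proof. rewrite /shift !brE; vring. Qed.

Lemma iter_shiftP n s a c x y : iter n (shift s a) (c *: x + y) =
  c *: iter n (shift s a) x + iter n (shift s a) y.
Proof. by elim: n => //= n ->; rewrite shiftP. Qed.

Lemma shift0 s a : shift s a 0 = 0.
Proof. by rewrite /shift br0r scaler0 subrr. Qed.

Lemma iter_shift0 n s a : iter n (shift s a) 0 = 0.
Proof. by elim: n => //= n ->; rewrite shift0. Qed.

Lemma gen_eigen0 s a : gen_eigen s a 0.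
Proof. by exists 0%N. Qed.

Lemma gen_eigenP s a c x y :
  gen_eigen s a x -> gen_eigen s a y -> gen_eigen s a (c *: x + y).
Proof.
move=> [m xm] [n yn]; exists (m + n)%N; rewrite iter_shiftP.
by rewrite {1}addnC !iterD xm yn !iter_shift0 scaler0 addr0.
Qed.

Lemma gen_eigen_shift s a x : gen_eigen s a (shift s a x) -> gen_eigen s a x.
Proof. by move=> [n xn]; exists n.+1; rewrite iterSr. Qed.

Lemma gen_eigen_br s a b x y :
  gen_eigen s a x -> gen_eigen s b y -> gen_eigen s (a + b) (br x y).
Proof.
move=> [m xm] [n yn]; have [k] := ubnP (m + n).
elim: k m n x y xm yn => // k IHk [|m] n x y xm yn.
  by move: xm => /= -> _; rewrite linear0l; apply: gen_eigen0.
case: n yn => [|n] yn.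
  by move: yn => /= -> _; rewrite linear0r; apply: gen_eigen0.
rewrite addSn ltnS => ltk; apply: gen_eigen_shift.
have -> : shift s (a + b) (br x y)
    = 1 *: br (shift s a x) y + br x (shift s b y).
  rewrite /shift jacobi !brE; vring.
apply: gen_eigenP.
  by apply: (IHk m n.+1) => //; rewrite -iterSr.
by apply: (IHk m.+1 n); rewrite -?iterSr // addSnnS.
Qed.

Lemma gen_eigen_uniq (W : {vspace g}) s a b v :
    (forall x, x \in W -> br s x \in W) -> v \notin W ->
  gen_eigen s a v -> br s v - b *: v \in W -> a = b.
Proof.
move=> Ws vW [n vn] sv; apply: contraNeq vW => neq_ab.
have: (b - a) ^+ n *: v \in W.
  rewrite -[_ *: v](subrK (iter n (shift s a) v)) vn addr0 -{1}vn => {vn}.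
  elim: n => [|n IHn]; first by rewrite expr0 scale1r subrr mem0v.
  have -> : (b - a) ^+ n.+1 *: v - iter n.+1 (shift s a) v =
      shift s a ((b - a) ^+ n *: v - iter n (shift s a) v)
      - (b - a) ^+ n *: (br s v - b *: v).
    rewrite iterS; set w := iter n _ _; rewrite exprS /shift !brE; vring.
  by rewrite rpredB // ?rpredZ // /shift rpredB ?rpredZ ?Ws.
rewrite rpredZeq expf_eq0 subr_eq0 [b == a]eq_sym (negPf neq_ab) andbF.
by [].
Qed.

Lemma eigenvector_mod (V W : {vspace g}) s :
    (forall x, x \in V -> br s x \in V) -> ~~ (V <= W)%VS ->
  exists a v, [/\ v \in V, v \notin W & shift s a v \in W].
Proof.
move=> Vs /subvPn[v Vv Wv]; have [rs rs0] := lfun_annihilator (br s).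
have: foldr (fun a u => br s u - a *: u) v rs \in W by rewrite rs0 mem0v.
elim: rs {rs0} => [|a rs IHrs] /=; first by rewrite (negPf Wv).
set u := foldr _ _ _ in IHrs *.
have Vu : u \in V.
  rewrite /u; elim: (rs) => //= b l IHl.
  by rewrite rpredB ?rpredZ ?Vs.
by have [/IHrs //|Wu sW] := boolP (u \in W); exists a, u.
Qed.

(* If [[s, d] = c] modulo [W], then [d - a] kills [(c^k k!) v0] only after [k + 1]
   steps from [s^k v0], so the sequence [s^k v0] has no linear relation. *)
Lemma central_commutator_mod (V W : {vspace g}) s d a c v0 :
    (forall x, x \in V -> br s x \in V) -> (forall x, x \in V -> br d x \in V) ->
    (forall x, x \in W -> br s x \in W) -> (forall x, x \in W -> br d x \in W) ->
    (forall v, v \in V -> br (br s d) v - c *: v \in W) ->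
    v0 \in V -> v0 \notin W -> shift d a v0 \in W -> c = 0.
Proof.
move=> Vs Vd Ws Wd Wc Vv0 Wv0 dv0; apply: contraNeq Wv0 => c_neq0.
pose n := shift d a.
have Vn u : u \in V -> n u \in V by move=> Vu; rewrite /n /shift rpredB ?rpredZ ?Vd.
have Wn u : u \in W -> n u \in W by move=> Wu; rewrite /n /shift rpredB ?rpredZ ?Wd.
have nB u v : n (u - v) = n u - n v by rewrite /n /shift !brE; vring.
have nD u v : n (u + v) = n u + n v by rewrite /n /shift !brE; vring.
have nZ e u : n (e *: u) = e *: n u by rewrite /n /shift !brE; vring.
have Vnk k u : u \in V -> iter k n u \in V by move=> Vu; elim: k => //= k; apply: Vn.
have comm1 u : u \in V -> n (br s u) - br s (n u) + c *: u \in W.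
  move=> Vu; rewrite -rpredN.
  have -> // : - (n (br s u) - br s (n u) + c *: u) = br (br s d) u - c *: u.
    rewrite /n /shift !brE (jacobi d) (br_anti d s) !brE; vring.
  exact: Wc.
have n0 k : iter k n 0 = 0 by exact: iter_shift0.
have {dv0} nv0 : n v0 \in W by [].
clearbody n.
have comm k u : u \in V ->
    iter k n (br s u) - br s (iter k n u) + (k%:R * c) *: iter k.-1 n u \in W.
  move=> Vu; elim: k => [|k IHk].
    by rewrite mul0r scale0r addr0 subrr mem0v.
  have -> : iter k.+1 n (br s u) - br s (iter k.+1 n u) + (k.+1%:R * c) *: iter k n u
     = n (iter k n (br s u) - br s (iter k n u) + (k%:R * c) *: iter k.-1 n u)
     + (n (br s (iter k n u)) - br s (n (iter k n u)) + c *: iter k n u).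
    rewrite nD nB nZ.
    have -> : (k%:R * c) *: n (iter k.-1 n u) = (k%:R * c) *: iter k n u.
      by case: (k) => //=; rewrite mul0r !scale0r.
    rewrite !iterS -[k.+1]addn1 natrD.
    vring.
  by rewrite rpredD ?Wn ?comm1 ?Vnk.
have [rs rs0] := lfun_annihilator (br s).
suff [_ _] : let w := foldr (fun b u => br s u - b *: u) v0 rs in
    [/\ w \in V, iter (size rs).+1 n w \in W &
        iter (size rs) n w \in W -> v0 \in W].
  apply; rewrite rs0; have -> : iter (size rs) n 0 = 0; last exact: mem0v.
  exact: n0.
elim: rs {rs0} => [|b rs IHrs] /=; first by split.
set w := foldr _ _ _ in IHrs *; move: IHrs => /= [Vw Ww1 Ww].
have VZ x e y : x \in V -> y \in V -> x - e *: y \in V.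
  by move=> Vx Vy; rewrite rpredB ?rpredZ.
have iterB k e x y : iter k n (x - e *: y) = iter k n x - e *: iter k n y.
  by elim: k => //= k ->; rewrite nB nZ.
have key k : iter k.+1 n (br s w - b *: w) =
    (iter k.+1 n (br s w) - br s (iter k.+1 n w) + (k.+1%:R * c) *: iter k n w)
    + (br s (iter k.+1 n w) - b *: iter k.+1 n w) - (k.+1%:R * c) *: iter k n w.
  by rewrite iterB; vring.
have W2 : iter (size rs).+2 n w \in W by exact: Wn.
split; first exact: VZ (Vs _ Vw) Vw.
  rewrite -/(iter (size rs).+2 n _) key.
  apply: rpredB; last exact: rpredZ.
  apply: rpredD; first exact: comm.
  by apply: rpredB; [exact: Ws | exact: rpredZ].
rewrite -/(iter (size rs).+1 n _) key rpredBl.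
  by rewrite rpredZeq mulf_eq0 pnatr_eq0 /= (negPf c_neq0) => /Ww.
apply: rpredD; first exact: comm.
by apply: rpredB; [exact: Ws | exact: rpredZ].
Qed.

Section Cartan.
Variable h : {vspace g}.
Hypothesis Hcartan : cartan_subalgebra br h.

Definition h_stable (V : {vspace g}) :=
  forall s x, s \in h -> x \in V -> br s x \in V.

Lemma h_stable_h : h_stable h.
Proof. by have [sub _ _] := Hcartan; move=> s x; apply: sub. Qed.

Lemma h_stable0 : h_stable 0%VS.
Proof. by move=> s x _; rewrite memv0 => /eqP ->; rewrite br0r mem0v. Qed.

Lemma lower_central_br n s d :
  s \in h -> lower_central br h n d -> lower_central br h n.+1 (br s d).
Proof.
move=> hs Dd; exists [:: (1, br s d)]; split.
  by move=> p; rewrite inE => /eqP -> /=; exists s => //; exists d.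
by rewrite big_seq1 scale1r.
Qed.

Lemma nilpotent_descent (P : g -> Prop) :
    ~ P 0 -> (exists2 d, d \in h & P d) ->
  exists d, [/\ d \in h, P d & forall s, s \in h -> ~ P (br s d)].
Proof.
move=> P0 [d0 hd0 Pd0]; apply: contrapT => noext.
have [_ [N DN] _] := Hcartan.
suff [d [hd Pd /DN /= d0E]] : exists d, [/\ d \in h, P d & lower_central br h N d].
  by apply: P0; rewrite -d0E.
elim: (N) => [|n [d [hd Pd Dd]]]; first by exists d0.
have [s hs Ps] : exists2 s, s \in h & P (br s d).
  apply: contrapT => nos; apply: noext; exists d; split=> // s hs Ps.
  by apply: nos; exists s.
by exists (br s d); split=> //; [exact: h_stable_h | exact: lower_central_br].
Qed.

Lemma gen_eigen_h s t : s \in h -> t \in h -> gen_eigen s 0 t.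
Proof.
move=> hs ht; have [_ [N DN] _] := Hcartan; exists N; apply: DN.
elim: (N) => // n IHn; rewrite iterS /shift scale0r subr0.
exact: lower_central_br.
Qed.

Lemma lie_mod (V W : {vspace g}) :
    h_stable V -> h_stable W -> (W <= V)%VS -> ~~ (V <= W)%VS ->
  exists v, [/\ v \in V, v \notin W &
    forall s, s \in h -> exists c, br s v - c *: v \in W].
Proof.
have [k] := ubnP (\dim V); elim: k V => // k IHk V; rewrite ltnS => dimV sV sW WV nVW.
pose scalar d := exists c, forall v, v \in V -> br d v - c *: v \in W.
have [nonscal|allscal] := pselect (exists2 d, d \in h & ~ scalar d); last first.
  have /subvPn[v Vv Wv] := nVW; exists v; split=> // s hs.
  have [c sc] : scalar s by apply: contrapT => ns; apply: allscal; exists s.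
  by exists c; apply: sc.
have scalar0 : ~ ~ scalar 0.
  by apply; exists 0 => v _; rewrite br0l scale0r subrr mem0v.
have [d [hd nd comm]] := nilpotent_descent scalar0 nonscal.
have [a [v0 [Vv0 Wv0 dv0]]] := eigenvector_mod (fun x => sV d x hd) nVW.
have comm0 s v : s \in h -> v \in V -> br (br s d) v \in W.
  move=> hs Vv; have [c sc] := contrapT (comm s hs).
  have c0 : c = 0.
    exact: (central_commutator_mod (fun x => sV s x hs) (fun x => sV d x hd)
      (fun x => sW s x hs) (fun x => sW d x hd) sc Vv0 Wv0 dv0).
  by have := sc v Vv; rewrite c0 scale0r subr0.
have shW x : x \in W -> shift d a x \in W.
  by move=> Wx; rewrite /shift rpredB ?rpredZ ?sW.
have [|b x y [Vx Wx] [Vy Wy]|U UE] :=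
  @vspace_of_pred _ _ (fun v => v \in V /\ shift d a v \in W).
- by rewrite mem0v shift0 mem0v.
- by split; rewrite ?shiftP rpredD ?rpredZ.
have UV : (U <= V)%VS by apply/subvP => x /UE[].
have ltU : (\dim U < k)%N.
  apply: leq_trans dimV; rewrite (ltn_leqif (dimv_leqif_sup UV)).
  apply/negP => /subvP VU; apply: nd; exists a => v Vv.
  by have /UE[] := VU v Vv.
have sU : h_stable U.
  move=> s x hs /UE[Vx Wx]; apply/UE; split; first exact: sV.
  have -> : shift d a (br s x) = br s (shift d a x) - br (br s d) x.
    rewrite /shift !brE (jacobi d) (br_anti d s) !brE; vring.
  by apply: rpredB; [exact: sW | exact: comm0].
have WU : (W <= U)%VS by apply/subvP => x Wx; apply/UE; rewrite (subvP WV) ?shW.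
have nUW : ~~ (U <= W)%VS by apply/subvPn; exists v0 => //; apply/UE.
by have [v [/UE[Vv _] Wv sv]] := IHk U ltU sU sW WU nUW; exists v.
Qed.

Definition gen_weight (l : dual h) x :=
  forall s : subvs_of h, gen_eigen (vsval s) (l s) x.

Lemma gen_weight0 l : gen_weight l 0.
Proof. by move=> s; apply: gen_eigen0. Qed.

Lemma gen_weightP l c x y :
  gen_weight l x -> gen_weight l y -> gen_weight l (c *: x + y).
Proof. by move=> lx ly s; apply: gen_eigenP. Qed.

Lemma gen_weight_br l m x y :
  gen_weight l x -> gen_weight m y -> gen_weight (l + m) (br x y).
Proof. by move=> lx my s; rewrite lfunE; apply: gen_eigen_br. Qed.

Lemma gen_weight_h s : s \in h -> gen_weight 0 s.
Proof. by move=> hs t; rewrite lfunE; apply: gen_eigen_h => //; apply: subvsP. Qed.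

Lemma h_of_gen_weight0 x : gen_weight 0 x -> x \in h.
Proof.
have [V VE] := vspace_of_pred (gen_weight0 0) (@gen_weightP 0).
have hV : (h <= V)%VS by apply/subvP => s hs; apply/VE/gen_weight_h.
have sV : h_stable V.
  move=> s y hs /VE y0; apply/VE; rewrite -[0]addr0.
  exact: gen_weight_br (gen_weight_h hs) y0.
move=> x0; have Vx : x \in V by apply/VE.
have [/subvP -> //|nVh] := boolP (V <= h)%VS.
have [v [Vv hv sv]] := lie_mod sV h_stable_h hV nVh.
have [_ _ sn] := Hcartan; have /negP[] := hv; apply: sn => s hs.
have [c sc] := sv s hs; have /VE/(_ (Subvs hs)) := Vv; rewrite lfunE /= => gv.
have c0 := gen_eigen_uniq (fun x => h_stable_h hs) hv gv sc.
by rewrite br_anti rpredN; move: sc; rewrite -c0 scale0r subr0.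
Qed.

Lemma lfun_eigenvalue v (c : g -> K) : v != 0 ->
    (forall s, s \in h -> br s v = c s *: v) ->
  exists l : dual h, forall s, br (vsval s) v = (l s : K) *: v.
Proof.
move=> v0 cv; have fv : free [:: v] by rewrite seq1_free.
pose f (s : subvs_of h) : K^o := coord [tuple v] ord0 (br (vsval s) v).
have lf : linear f.
  move=> a s t; rewrite /f linearP /= linearPl; exact: linearP.
pose F := GRing.isLinear.Build K (subvs_of h) K^o _ f lf.
pose fL : {linear subvs_of h -> K^o} := HB.pack f F.
have v1 : coord [tuple v] ord0 v = 1 := coord_free ord0 ord0 fv.
exists (linfun fL) => s; rewrite lfunE /= /f cv ?subvsP //; congr (_ *: v).
by rewrite linearZ_LR /= v1; apply/esym/mulr1.
Qed.

Lemma gen_weight_eigenvector (V : {vspace g}) : h_stable V -> V != 0%VS ->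
  exists (l : dual h) v, [/\ v \in V, v != 0 & root_space br l v].
Proof.
move=> sV V0; have nV0 : ~~ (V <= 0)%VS by rewrite subv0.
have [v [Vv v0 sv]] := lie_mod sV h_stable0 (sub0v V) nV0.
have {}v0 : v != 0 by rewrite -memv0.
have /choice[c cv] : forall s, exists c, s \in h -> br s v = c *: v.
  move=> s; have [hs|_] := boolP (s \in h); last by exists 0.
  by have [c /[!memv0]/eqP/subr0_eq sc] := sv s hs; exists c.
by have [l lv] := lfun_eigenvalue v0 cv; exists l, v.
Qed.

Lemma gen_weight_uniq (s : g) a b v : v != 0 ->
  gen_eigen s a v -> br s v = b *: v -> a = b.
Proof.
move=> v0 gv sv; apply: (@gen_eigen_uniq 0%VS s a b v) => //.
- by move=> x /[!memv0]/eqP ->; rewrite br0r.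
- by rewrite memv0.
by rewrite sv subrr mem0v.
Qed.

Lemma h_stable_pred (V : {vspace g}) (l : dual h) :
  (forall x, x \in V <-> gen_weight l x) -> h_stable V.
Proof.
move=> VE s x hs /VE lx; apply/VE; rewrite -[l]add0r.
exact: gen_weight_br (gen_weight_h hs) lx.
Qed.

Lemma gen_weight_root l x : x != 0 -> gen_weight l x -> l != 0 -> Defs.roots br l.
Proof.
move=> x0 lx l0; split=> //.
have [V VE] := vspace_of_pred (gen_weight0 l) (@gen_weightP l).
have V0 : V != 0%VS.
  by apply: contraNneq x0 => V0; rewrite -memv0 -V0; apply/VE.
have [m [v [/VE Vv v0 mv]]] := gen_weight_eigenvector (h_stable_pred VE) V0.
exists v => // s; have -> // : l s = m s.
exact: gen_weight_uniq v0 (Vv s) (mv s).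
Qed.

Lemma root_space_gen_weight l x : root_space br l x -> gen_weight l x.
Proof. by move=> lx s; exists 1%N; rewrite /= /shift lx subrr. Qed.

Lemma gen_eigen_ind (V : {vspace g}) s (Q : g -> Prop) :
    (forall x, x \in V -> br s x \in V) -> Q 0 ->
    (forall x y, Q x -> Q y -> Q (x + y)) ->
    (forall a x, x \in V -> gen_eigen s a x -> Q x) ->
  forall x, x \in V -> Q x.
Proof.
move=> Vs Q0 QD Qgen x Vx; have [rs rs0] := lfun_annihilator (br s).
have Vshift a y : y \in V -> shift s a y \in V.
  by move=> Vy; rewrite /shift rpredB ?rpredZ ?Vs.
(* On the generalized eigenspace of [b <> a], [ad s - a] is invertible. *)
have inv a b y : a != b -> y \in V -> gen_eigen s b y ->
    exists u, [/\ u \in V, gen_eigen s b u & shift s a u = y].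
  move=> ab Vy [n yn]; elim: n y Vy yn => [|n IHn] y Vy.
    move=> /= ->; exists 0; split; rewrite ?mem0v //; first exact: gen_eigen0.
    exact: shift0.
  rewrite iterSr => yn; have [u [Vu bu ua]] := IHn _ (Vshift b y Vy) yn.
  exists ((b - a)^-1 *: (y - u)); split; first by rewrite rpredZ ?rpredB.
    rewrite -[_ *: _]addr0; apply: gen_eigenP; last exact: gen_eigen0.
    rewrite -scaleN1r addrC; apply: gen_eigenP => //.
    by exists n.+1; rewrite iterSr.
  have -> : shift s a ((b - a)^-1 *: (y - u))
      = (b - a)^-1 *: (shift s a y - shift s a u) by rewrite /shift !brE; vring.
  rewrite ua; have -> : shift s a y - shift s b y = (b - a) *: y.
    by rewrite /shift; vring.
  by rewrite scalerA mulVf ?scale1r // subr_eq0 eq_sym.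
have {rs0} : foldr (fun a u => shift s a u) x (rev (rev rs)) = 0.
  by rewrite revK; apply: rs0.
elim: (rev rs) Q Q0 QD Qgen x Vx => [|a l IHl] Q Q0 QD Qgen x Vx.
  by move=> /= ->.
rewrite rev_cons foldr_rcons => lx.
pose Q' w := exists u, [/\ u \in V, Q u & gen_eigen s a (shift s a u - w)].
have [||b y Vy by_|u [Vu Qu gu]] := IHl Q' _ _ _ _ (Vshift a x Vx) lx.
- exists 0; split; rewrite ?mem0v // shift0 subrr; exact: gen_eigen0.
- move=> y z [u [Vu Qu gu]] [v [Vv Qv gv]]; exists (u + v); split.
  + by rewrite rpredD.
  + exact: QD.
  have -> : shift s a (u + v) - (y + z)
     = 1 *: (shift s a u - y) + (shift s a v - z) by rewrite /shift !brE; vring.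
  exact: gen_eigenP.
- have [ab|ab] := eqVneq a b; last first.
    have [u [Vu bu <-]] := inv a b y ab Vy by_.
    exists u; split=> //; first exact: Qgen bu.
    by rewrite subrr; apply: gen_eigen0.
  exists 0; split; rewrite ?mem0v //.
  have -> : shift s a 0 - y = -1 *: y + 0 by rewrite shift0; vring.
  apply: gen_eigenP; last exact: gen_eigen0.
  by rewrite ab.
rewrite -[x](subrK u) addrC; apply: QD => //; apply: (Qgen a).
  by rewrite rpredB.
apply: gen_eigen_shift.
have -> : shift s a (x - u) = -1 *: (shift s a u - shift s a x) + 0.
  by rewrite /shift !brE; vring.
by apply: gen_eigenP => //; apply: gen_eigen0.
Qed.

Lemma gen_weight_ind (Q : g -> Prop) : Q 0 ->
    (forall x y, Q x -> Q y -> Q (x + y)) ->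
    (forall l x, gen_weight l x -> Q x) -> forall x, Q x.
Proof.
move=> Q0 QD Qw x.
suff : forall V, h_stable V -> forall x, x \in V -> Q x.
  by move=> QV; apply: (QV fullv) => [s y _ _|]; apply: memvf.
move=> {x} V; have [k] := ubnP (\dim V); elim: k V => // k IHk V.
rewrite ltnS => dimV sV x Vx.
have [V0|V0] := eqVneq V 0%VS.
  by move: Vx; rewrite V0 memv0 => /eqP ->.
have [l [v0 [Vv0 v00 lv0]]] := gen_weight_eigenvector sV V0.
have [Vl|nVl] := pselect (forall x, x \in V -> gen_weight l x).
  exact: Qw (Vl x Vx).
have [s [v Vv nv]] : exists s : subvs_of h,
    exists2 v, v \in V & ~ gen_eigen (vsval s) (l s) v.
  apply: contrapT => no; apply: nVl => v Vv s; apply: contrapT => nv.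
  by apply: no; exists s, v.
have hs := subvsP s.
apply: (gen_eigen_ind (fun x => sV _ x hs)) Vx => // a y Vy ay.
have [||U UE] := @vspace_of_pred _ _ (fun v => v \in V /\ gen_eigen (vsval s) a v).
- by rewrite mem0v; split=> //; apply: gen_eigen0.
- move=> c z w [Vz az] [Vw aw]; split; first by rewrite rpredD ?rpredZ.
  exact: gen_eigenP.
have UV : (U <= V)%VS by apply/subvP => z /UE[].
apply: (IHk U); last by apply/UE.
  apply: leq_trans dimV; rewrite (ltn_leqif (dimv_leqif_sup UV)).
  apply/negP => /subvP VU; apply: nv; have /UE[_ av] := VU v Vv.
  have /UE[_ av0] := VU v0 Vv0.
  by rewrite -(gen_weight_uniq v00 av0 (lv0 s)).
move=> t z ht /UE[Vz az]; apply/UE; split; first exact: sV.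
rewrite -[a]add0r; apply: gen_eigen_br => //; exact: gen_eigen_h.
Qed.

Definition admx x : 'M_(dim g) := lin1_mx (v2r \o br x \o r2v).
Definition killing x y := \tr (admx x *m admx y).

Lemma admxE x v : v2r v *m admx x = v2r (br x v).
Proof. by rewrite mul_rV_lin1 /= v2rK. Qed.

Lemma admx_ext (A B : 'M_(dim g)) : (forall v, v2r v *m A = v2r v *m B) -> A = B.
Proof.
move=> AB; apply/row_matrixP => i; rewrite !rowE -(r2vK (delta_mx 0 i)).
exact: AB.
Qed.

Lemma admxP c x y : admx (c *: x + y) = c *: admx x + admx y.
Proof.
apply: admx_ext => v.
by rewrite mulmxDr -scalemxAr !admxE !brE !v2rE.
Qed.

Lemma admx_br x y : admx (br x y) = admx y *m admx x - admx x *m admx y.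
Proof.
apply: admx_ext => v; rewrite mulmxBr !mulmxA !admxE (jacobi x) v2rE.
by rewrite addrK.
Qed.

Lemma killingC x y : killing x y = killing y x.
Proof. exact: mxtrace_mulC. Qed.

Lemma killingPl c x y z : killing (c *: x + y) z = c * killing x z + killing y z.
Proof. by rewrite /killing admxP mulmxDl -scalemxAl mxtraceD mxtraceZ. Qed.

Lemma killing0l z : killing 0 z = 0.
Proof.
by have := killingPl (-1) 0 0 z; rewrite scaler0 addr0 mulN1r addNr.
Qed.

Lemma killing_invariant x y z : killing (br x y) z = killing x (br y z).
Proof.
rewrite /killing !admx_br mulmxBl mulmxBr !raddfB /= !mulmxA; congr (_ - _).
by rewrite [RHS]mxtrace_mulC mulmxA.
Qed.

Lemma killing_eigenvalues x y : exists2 rs : seq K,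
  killing x y = \sum_(r <- rs) r &
  forall a, a \in rs <-> exists2 v, v != 0 & br y (br x v) = a *: v.
Proof.
have [rs trE rsE] := mxtrace_eigenvalues (admx x *m admx y).
exists rs => // a; rewrite rsE; split=> [/eigenvalueP[u]|[v v0 av]].
  rewrite -(r2vK u) mulmxA !admxE -v2rE => /(can_inj v2rK) av u0.
  by exists (r2v u) => //; apply: contraNneq u0 => ->; rewrite v2rE.
apply/eigenvalueP; exists (v2r v); first by rewrite mulmxA !admxE av v2rE.
by apply: contraNneq v0 => v0; rewrite -(v2rK v) v0 linear0.
Qed.

Section SimpleHighestRoot.
Variables (P : set (dual h)) (eta : dual h).
Hypotheses (Hsimple : simple_lie br) (Hpos : positive_system br P).
Hypotheses (Heta : longest_root br P eta) (Heta1 : simple_roots P eta).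
Hypothesis HetaN : Defs.roots br (- eta).

Let P_root l : P l -> Defs.roots br l. Proof. by have [+ _ _ _] := Hpos; apply. Qed.
Let root_P l : Defs.roots br l -> P l \/ P (- l).
Proof. by have [_ + _ _] := Hpos; apply. Qed.
Let PN l : P l -> P (- l) -> False.
Proof. by have [_ _ PN _] := Hpos => Pl PNl; apply: (PN l). Qed.
Let PD l m : P l -> P m -> Defs.roots br (l + m) -> P (l + m).
Proof. by have [_ _ _] := Hpos; apply. Qed.
Let Peta : P eta. Proof. by have [] := Heta. Qed.
Let eta_max l : P l -> Defs.roots br (l + eta) -> False.
Proof. by have [_ +] := Heta => /[apply]. Qed.
Let eta_indec l m : P l -> P m -> eta = l + m -> False.
Proof. by move=> Pl Pm E; have [_] := Heta1; apply; exists l, m. Qed.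

Lemma eta_strings l : Defs.roots br l -> l != - eta -> 
  ~ Defs.roots br (l + eta).
Proof.
move=> rl lNeta rle; have [Pl|PNl] := root_P rl; first exact: eta_max Pl rle.
have [Ple|PNle] := root_P rle.
  by apply: (eta_indec Ple PNl); rewrite addrAC subrr add0r.
by apply: (eta_max PNle); rewrite opprD subrK; apply: P_root.
Qed.

Lemma eta_stringsN l : Defs.roots br l -> l != eta -> 
  ~ Defs.roots br (l - eta).
Proof.
move=> rl leta rle; have [Pl|PNl] := root_P rl; have [Ple|PNle] := root_P rle.
- by apply: (eta_max Ple); rewrite subrK.
- by apply: (eta_indec Pl PNle); rewrite opprB addrC subrK.
- by apply: (PN Peta); rewrite -[- eta](addKr l); apply: PD => //; rewrite addKr.
- by apply: (eta_max PNl); rewrite addrC -opprB; apply: P_root.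
Qed.

Lemma simple_ideal_full (Q : g -> Prop) : Q 0 ->
    (forall a x y, Q x -> Q y -> Q (a *: x + y)) ->
    (forall x y, Q y -> Q (br x y)) -> (exists2 x, x != 0 & Q x) ->
  forall x, Q x.
Proof.
move=> Q0 QL Qbr [x x0 Qx] y; have [I IE] := vspace_of_pred Q0 QL.
have [_ /(_ I)] := Hsimple; case=> [u v /IE Qv|I0|IT]; first exact/IE/Qbr.
  by move/IE: Qx; rewrite I0 memv0 (negPf x0).
by apply/IE; rewrite IT memvf.
Qed.

Lemma simple_centerless x : (forall y, br y x = 0) -> x = 0.
Proof.
move=> x_central; apply: contrapT => /eqP x0.
have [[u [v]]] := Hsimple; suff -> : br u v = 0 by rewrite eqxx.
move: v u; apply: simple_ideal_full; last by exists x.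
- by move=> u; rewrite br0r.
- by move=> a v w v0 w0 u; rewrite !brE v0 w0 scaler0 addr0.
- by move=> v w w0 u; rewrite !w0 br0r.
Qed.

Let eta0 : eta != 0. Proof. by have [] := P_root Peta. Qed.

Let etaN : eta != - eta.
Proof. by apply/eqP => E; apply: (PN Peta); rewrite -E. Qed.

Lemma gen_weight_br_eq0 l m x y : gen_weight l x -> gen_weight m y ->
  l + m != 0 -> ~ Defs.roots br (l + m) -> br x y = 0.
Proof.
move=> lx my lm0 nlm; apply: contrapT => /eqP xy0; apply: nlm.
exact: gen_weight_root xy0 (gen_weight_br lx my) lm0.
Qed.

Lemma br_eta_eq0 l x y : Defs.roots br l -> l != eta -> l != - eta ->
  gen_weight l x -> gen_weight eta y \/ gen_weight (- eta) y -> br x y = 0.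
Proof.
move=> rl le lNe lx [ey|ey]; apply: gen_weight_br_eq0 lx ey _ _.
- by rewrite addr_eq0.
- exact: eta_strings.
- by apply: contra_neq le; apply: subr0_eq.
- exact: eta_stringsN.
Qed.

(* The elements commuting with all root spaces other than those of [eta] and
   [- eta] form an ideal containing the root space of [eta]. *)
Lemma gen_weight_eta l x : gen_weight l x -> x != 0 ->
  [\/ l = 0, l = eta | l = - eta].
Proof.
move=> lx x0; have [->|l0] := eqVneq l 0; first by constructor 1.
have [->|le] := eqVneq l eta; first by constructor 2.
have [->|lNe] := eqVneq l (- eta); first by constructor 3.
have rl := gen_weight_root x0 lx l0.
case/eqP: x0; apply: simple_centerless => y; rewrite br_anti; apply/eqP.
rewrite oppr_eq0; apply/eqP; move: l x {l0} rl le lNe lx.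
pose C z := forall l x, Defs.roots br l -> l != eta -> l != - eta ->
  gen_weight l x -> br x z = 0.
suff : C y by [].
move: y; apply: simple_ideal_full.
- by move=> l x *; rewrite br0r.
- by move=> a u v Cu Cv l x *; rewrite !brE (Cu l) ?(Cv l) ?scaler0 ?addr0.
- move=> u v Cv; move: u; apply: gen_weight_ind.
  + by rewrite br0l => l x *; rewrite br0r.
  + by move=> u w Cu Cw l x *; rewrite !brE (Cu l) ?(Cw l) ?addr0.
  move=> m u mu l x rl le lNe lx.
  have [->|u0] := eqVneq u 0; first by rewrite br0l br0r.
  have [m0|m0] := eqVneq m 0.
    rewrite jacobi (Cv l x) // br0r addr0.
    by apply: (Cv l) => //; rewrite -[l]addr0 -m0; apply: gen_weight_br.
  have [me|me] := eqVneq m eta.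
    rewrite jacobi (Cv l x) // br0r addr0.
    by rewrite (br_eta_eq0 rl le lNe lx) ?br0l // -me; left.
  have [mNe|mNe] := eqVneq m (- eta).
    rewrite jacobi (Cv l x) // br0r addr0.
    by rewrite (br_eta_eq0 rl le lNe lx) ?br0l // -mNe; right.
  have rm := gen_weight_root u0 mu m0.
  by rewrite (Cv m u) // br0r.
have [_ [e e0 ee]] := P_root Peta; exists e => // l x rl le lNe lx.
by apply: br_eta_eq0 lx _ => //; left; apply: root_space_gen_weight.
Qed.

Lemma ad_eigenvalue (s : subvs_of h) a v : v != 0 -> br (vsval s) v = a *: v ->
  a ^+ 2 = 0 \/ a ^+ 2 = (eta s : K) ^+ 2.
Proof.
move=> v0 av.
have [U UE] := vspace_of_pred (gen_eigen0 (vsval s) a) (@gen_eigenP (vsval s) a).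
have sU : h_stable U.
  move=> t x ht /UE ax; apply/UE; rewrite -[a]add0r.
  by apply: gen_eigen_br => //; apply: gen_eigen_h => //; apply: subvsP.
have U0 : U != 0%VS.
  apply: contraNneq v0 => U0; rewrite -memv0 -U0; apply/UE.
  by exists 1%N; rewrite /= /shift av subrr.
have [l [w [/UE aw w0 lw]]] := gen_weight_eigenvector sU U0.
rewrite (gen_weight_uniq w0 aw (lw s)).
have [->|->|->] := gen_weight_eta (root_space_gen_weight lw) w0.
- by left; rewrite lfunE /= expr0n.
- by right.
by right; rewrite lfunE /=; apply: sqrrN.
Qed.

Lemma killing_diag (s : subvs_of h) :
  exists2 m, (0 < m)%N & killing (vsval s) (vsval s) = m%:R * (eta s : K) ^+ 2.
Proof.
set e : K := eta s ^+ 2; have [rs -> rsE] := killing_eigenvalues (vsval s) (vsval s).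
have rs_e : e \in rs.
  apply/rsE; have [_ [v v0 ev]] := P_root Peta; exists v => //.
  by rewrite ev brZr ev scalerA -expr2.
exists (count_mem e rs); first by rewrite -has_count has_pred1.
have rs0e : forall r, r \in rs -> r = 0 \/ r = e.
  move=> r /rsE[v v0 rv]; set a := sqrtC r; have ra : r = a ^+ 2 by rewrite sqrtCK.
  suff [b [w [w0 bw rb]]] : exists b w,
      [/\ w != 0, br (vsval s) w = b *: w & r = b ^+ 2].
    by rewrite rb; apply: ad_eigenvalue bw.
  have [wE|w0] := eqVneq (br (vsval s) v + a *: v) 0.
    exists (- a), v; split=> //; last by rewrite sqrrN.
    by apply/eqP; rewrite scaleNr -addr_eq0 wE.
  exists a, (br (vsval s) v + a *: v); split=> //.
  by rewrite !brE rv ra scalerDr scalerA expr2 addrC.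
elim: rs {rs_e rsE} rs0e => [|r rs IHrs] rs0e; first by rewrite big_nil mul0r.
rewrite big_cons IHrs => [|r' rs_r']; last by apply: rs0e; rewrite inE rs_r' orbT.
rewrite /= natrD mulrDl; congr (_ + _).
have [->|->] := rs0e r (mem_head _ _); last by rewrite eqxx mul1r.
by have [<-|_] := eqVneq 0 e; rewrite ?mulr0 ?mul0r.
Qed.

(* [killing (s + c z) (s + c z)] is a natural multiple of [eta s ^ 2], and is affine in
   [c] with slope [2 killing z s]; so the slope vanishes. *)
Lemma killing_ker_h (z s : subvs_of h) :
  (eta z : K) = 0 -> killing (vsval z) (vsval s) = 0.
Proof.
move=> z0; apply/eqP/negPn/negP => b0; set b := killing _ _ in b0.
set e : K := eta s ^+ 2.
have zz : killing (vsval z) (vsval z) = 0.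
  by have [m _ ->] := killing_diag z; rewrite z0 expr0n mulr0.
have [m0 _ sE] := killing_diag s; rewrite -/e in sE.
have szE c : exists m, m0%:R * e + 2 * c * b = m%:R * e :> K.
  have [u [uE eu]] : exists u : subvs_of h,
      vsval u = c *: vsval z + vsval s /\ (eta u : K) = eta s.
    exists (c *: z + s); split; first exact: linearP.
    by rewrite linearP /=; apply/eqP; rewrite -subr_eq0 addrK z0 scaler0.
  have [m _ uu] := killing_diag u; exists m; rewrite eu uE -/e in uu; rewrite -uu.
  rewrite killingPl ![killing _ (_ + _)]killingC !killingPl.
  by rewrite zz sE [killing (vsval s) _]killingC -/b; ring.
have [e0|e0] := eqVneq e 0.
  have [m] := szE 1; rewrite e0 !mulr0 add0r mulr1 => /eqP.
  by rewrite mulf_eq0 pnatr_eq0 (negPf b0).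
have [m] := szE (e / (4 * b)) => mE.
have : (m0%:R * 2 + 1) * e = (m%:R * 2) * e.
  rewrite -[RHS]mulrAC -mE; field; apply/eqP/eqP => //.
move/(mulIf e0)/eqP; rewrite -!natrM natr1 eqr_nat => /eqP/(congr1 odd).
by rewrite /= !oddM !andbF.
Qed.

Lemma killing_ker_eta (z : g) x : z \in h ->
  gen_weight eta x \/ gen_weight (- eta) x -> killing z x = 0.
Proof.
move=> hz xe; rewrite killingC.
suff F0 v : iter 3 (fun w => br z (br x w)) v = 0.
  have [rs -> rsE] := killing_eigenvalues x z.
  rewrite big_seq big1 // => r /rsE[v v0 rv]; apply/eqP.
  have := F0 v; rewrite /= rv !brE rv !brE rv !scalerA => /eqP.
  by rewrite scaler_eq0 (negPf v0) orbF !mulf_eq0 !orbb.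
have [th [xth thE]] : exists th, gen_weight th x /\ (th = eta \/ th = - eta).
  by case: xe => xe; [exists eta | exists (- eta)]; split; auto.
have th2 w : gen_weight th w -> br z (br x w) = 0.
  move=> thw; suff -> : br x w = 0 by rewrite br0r.
  apply: gen_weight_br_eq0 xth thw _ _.
    case: thE => ->; last by rewrite -opprD oppr_eq0 addr_eq0.
    by rewrite addr_eq0.
  case: thE => ->; first by apply: eta_strings => //; apply: P_root.
  by apply: eta_stringsN => //; rewrite eq_sym.
have gx l w : gen_weight l w -> gen_weight (th + l) (br z (br x w)).
  move=> lw; rewrite -[_ + l]add0r; apply: gen_weight_br (gen_weight_h hz) _.
  exact: gen_weight_br.
have th1 w : gen_weight 0 w -> br z (br x (br z (br x w))) = 0.
  by move=> w0; apply: th2; rewrite -[th]addr0; apply: gx.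
have thN w : gen_weight (- th) w -> iter 3 (fun w => br z (br x w)) w = 0.
  by move=> w0; apply: th1; rewrite -(subrr th); apply: gx.
move: v; apply: gen_weight_ind.
- by rewrite /= !brE.
- by move=> u w /= u0 w0; rewrite !brE u0 w0 addr0.
move=> l w lw; have [->|w0] := eqVneq w 0; first by rewrite /= !brE.
have [l0|le|le] := gen_weight_eta lw w0.
- by rewrite /= (th1 w) ?brE // -l0.
- case: thE => thE; first by rewrite /= (th2 w) ?brE // thE -le.
  by apply: thN; rewrite thE opprK -le.
case: thE => thE; last by rewrite /= (th2 w) ?brE // thE -le.
by apply: thN; rewrite thE -le.
Qed.

(* Otherwise [ker eta] meets [h], and its elements lie in the radical of the Killing
   form; the radical is then all of [g], against [killing_diag]. *)
Lemma dim_cartan_simple_highest_root : (\dim h < 2)%N.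
Proof.
rewrite ltnNge; apply/negP => dimh.
have ker0 : lker eta != 0%VS.
  apply: contraTneq dimh => k0; rewrite -ltnNge ltnS.
  have := limg_ker_dim eta fullv; rewrite capfv k0 dimv0 add0n dimvf => dimE.
  have <- : \dim (limg eta) = \dim h by [].
  by rewrite (leq_trans (dimvS (subvf _))) // dimvf.
have [z z0 ez] : exists2 z : subvs_of h, z != 0 & (eta z : K) = 0.
  exists (vpick (lker eta)); first by rewrite vpick0.
  by have := memv_pick (lker eta); rewrite memv_ker => /eqP.
have [t et] : exists t : subvs_of h, (eta t : K) != 0.
  apply: contrapT => no; case/eqP: eta0; apply/lfunP => t; rewrite lfunE /=.
  by apply/eqP; apply: contrapT => /negP et; apply: no; exists t.
suff rad : forall x y, killing x y = 0.
  have [m m0] := killing_diag t; rewrite rad => /esym/eqP.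
  by rewrite mulf_eq0 expf_eq0 /= pnatr_eq0 (negPf et) orbF eqn0Ngt m0.
apply: simple_ideal_full.
- exact: killing0l.
- by move=> a u v u0 v0 y; rewrite killingPl u0 v0 mulr0 addr0.
- move=> u v v0 y; rewrite br_anti -scaleN1r -[_ *: _]addr0 killingPl.
  rewrite killing_invariant v0 mulr0 add0r.
  exact: killing0l.
exists (vsval z) => // y; move: y; apply: gen_weight_ind.
- by rewrite killingC killing0l.
- by move=> u v u0 v0; rewrite killingC -[u]scale1r killingPl ![killing _ (vsval z)]killingC
    u0 v0 mulr0 addr0.
move=> l x lx; have [->|x0] := eqVneq x 0.
  by rewrite killingC killing0l.
have [l0|le|le] := gen_weight_eta lx x0.
- have hx : x \in h by apply: h_of_gen_weight0; rewrite -l0.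
  exact: (killing_ker_h (Subvs hx) ez).
- by apply: killing_ker_eta (subvsP z) _; left; rewrite -le.
- by apply: killing_ker_eta (subvsP z) _; right; rewrite -le.
Qed.
End SimpleHighestRoot.

Section RootSpaces.
Variables (P : set (dual h)) (eta : dual h).
Hypotheses (Hsimple : simple_lie br) (Hrank : (2 <= \dim h)%N).
Hypotheses (Hpos : positive_system br P) (Heta : longest_root br P eta).

Lemma lspan_sub (A T : set g) : T 0 ->
    (forall c x y, T x -> T y -> T (c *: x + y)) -> A `<=` T -> lspan A `<=` T.
Proof.
move=> T0 TL AT _ [s [As ->]]; elim: s As => [|p s IHs] As; first by rewrite big_nil.
rewrite big_cons; apply: TL; first by apply/AT/As; rewrite mem_head.
by apply: IHs => q sq; apply: As; rewrite inE sq orbT.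
Qed.

Lemma lspan0 (A : set g) : lspan A 0.
Proof. by exists [::]; split=> //; rewrite big_nil. Qed.

Lemma lspanP (A : set g) c x y : lspan A x -> lspan A y -> lspan A (c *: x + y).
Proof.
move=> [s [As ->]] [t [At ->]]; exists ([seq (c * p.1, p.2) | p <- s] ++ t); split.
  by move=> p; rewrite mem_cat => /orP[/mapP[q sq ->]|/At //]; exact: (As q sq).
rewrite big_cat big_map scaler_sumr /=; congr (_ + _).
by apply: eq_bigr => p _; rewrite scalerA.
Qed.

Lemma mem_root_sum (S : set (dual h)) l x :
  S l -> root_space br l x -> root_sum br S x.
Proof.
move=> Sl lx; exists [:: (1, x)]; split; last by rewrite big_seq1 scale1r.
by move=> p; rewrite inE => /eqP ->; exists l.
Qed.

Lemma lie_root_sum_sub (S S' : set (dual h)) (T : set g) : T 0 ->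
    (forall c x y, T x -> T y -> T (c *: x + y)) ->
    (forall l m x y, S l -> S' m -> x != 0 -> y != 0 -> root_space br l x ->
       root_space br m y -> T (br x y)) ->
  lie_set br (root_sum br S) (root_sum br S') `<=` T.
Proof.
move=> T0 TL TS; apply: lspan_sub => // _ [x Sx [y Sy <-]].
move: x Sx; apply: lspan_sub => [|c u v Tu Tv|x [l Sl lx]].
- by rewrite br0l.
- by rewrite !brE; apply: TL.
move: y Sy; apply: lspan_sub => [|c u v Tu Tv|y [m Sm my]].
- by rewrite br0r.
- by rewrite !brE; apply: TL.
have [->|x0] := eqVneq x 0; first by rewrite br0l.
have [->|y0] := eqVneq y 0; first by rewrite br0r.
exact: TS lx my.
Qed.

Lemma lie_h_root_sum (S : set (dual h)) :
  lie_set br [set` h] (root_sum br S) `<=` root_sum br S.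
Proof.
apply: lspan_sub => [||_ [s hs [y Sy <-]]]; [exact: lspan0 | exact: lspanP |].
move: y Sy; apply: lspan_sub => [|c u v Tu Tv|y [m Sm my]].
- by rewrite br0r; apply: lspan0.
- by rewrite !brE; apply: lspanP.
rewrite (my (Subvs hs)) -[_ *: _]addr0; apply: lspanP; last exact: lspan0.
exact: mem_root_sum my.
Qed.

Lemma root_space_br (l m : dual h) x y : root_space br l x -> root_space br m y ->
  root_space br (l + m) (br x y).
Proof.
by move=> lx my t; rewrite jacobi lx my !brE lfunE /= -scalerDl.
Qed.

Let R := Defs.roots br (h := h).
Let R0 : ~ R 0. Proof. by case=> /eqP. Qed.
Let PR : P `<=` R. Proof. by have [] := Hpos. Qed.
Let RP a : R a -> P a \/ P (- a). Proof. by have [_ + _ _] := Hpos; apply. Qed.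
Let PN a : ~ (P a /\ P (- a)). Proof. by have [_ _ + _] := Hpos; apply. Qed.
Let PD a b : P a -> P b -> R (a + b) -> P (a + b).
Proof. by have [_ _ _] := Hpos; apply. Qed.
Let Peta : P eta. Proof. by have [] := Heta. Qed.
Let eta_max a : P a -> ~ R (a + eta). Proof. by have [_] := Heta; apply. Qed.
Let eta_dec : R (- eta) -> ~ indecomposable P eta.
Proof.
move=> HetaN Heta1.
have := dim_cartan_simple_highest_root Hsimple Hpos Heta Heta1 HetaN.
by rewrite ltnNge Hrank.
Qed.

Let root_of (l : dual h) x : l != 0 -> x != 0 -> root_space br l x -> R l.
Proof. by move=> l0 x0 lx; split=> //; exists x. Qed.

Let Zdag_neq0 l : Zdag P eta l -> l != 0.
Proof.
case=> [[/PR[] //]|->]; rewrite oppr_eq0; by have [] := PR Peta.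
Qed.

Lemma lie_gZ_gZdag : lie_set br (g_Z br P eta) (g_Zdag br P eta) `<=` [set` h].
Proof.
apply: lie_root_sum_sub => [|c x y hx hy|l m x y [Rl Zl] Zm x0 y0 lx my] /=.
- exact: mem0v.
- by rewrite rpredD ?rpredZ.
have [->|xy0] := eqVneq (br x y) 0; first exact: mem0v.
have lmxy := root_space_br lx my.
have [lm0|lm0] := eqVneq (l + m) 0.
  by apply: h_of_gen_weight0; rewrite -lm0; apply: root_space_gen_weight.
have Rm : R m := root_of (Zdag_neq0 Zm) y0 my.
have := root_of lm0 xy0 lmxy; rewrite addrC -[l]opprK => Rlm.
by have := extended_simple_sub R0 PR RP PN PD Peta eta_max Zm Zl (or_introl Rm) Rlm.
Qed.

Let g1 := g_1 br P eta.

Lemma sum_set0 (A B : set g) : sum_set (lspan A) (lspan B) 0.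
Proof. by exists 0; [exact: lspan0 | exists 0; [exact: lspan0 | rewrite addr0]]. Qed.

Lemma sum_setP (A B : set g) c x y : sum_set (lspan A) (lspan B) x ->
  sum_set (lspan A) (lspan B) y -> sum_set (lspan A) (lspan B) (c *: x + y).
Proof.
move=> [a Aa [b Bb <-]] [a' Aa' [b' Bb' <-]].
exists (c *: a + a'); first exact: lspanP.
exists (c *: b + b'); first exact: lspanP.
by rewrite scalerDr addrACA.
Qed.

Lemma lie_sum_set (S S' A B : set (dual h)) :
    Zset br P eta `|` Zdag P eta = A `|` B ->
    (forall l m, S l -> S' m -> R l -> R m ->
       l + m != 0 /\ (R (l + m) -> ~ A (l + m))) ->
    (forall l, S l -> l != 0) -> (forall l, S' l -> l != 0) ->
  lie_set br (root_sum br S) (root_sum br S') `<=` sum_set g1 (root_sum br B).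
Proof.
move=> ZAB SS' S0 S'0.
apply: lie_root_sum_sub => [||l m x y Sl S'm x0 y0 lx my].
- exact: sum_set0.
- exact: sum_setP.
have [->|xy0] := eqVneq (br x y) 0; first exact: sum_set0.
have Rl := root_of (S0 l Sl) x0 lx; have Rm := root_of (S'0 m S'm) y0 my.
have [lm0 nA] := SS' l m Sl S'm Rl Rm.
have lmxy := root_space_br lx my; have Rlm := root_of lm0 xy0 lmxy.
have [Blm|nBlm] := pselect (B (l + m)).
  exists 0; first exact: lspan0.
  by exists (br x y); [exact: mem_root_sum lmxy | rewrite add0r].
exists (br x y); last by exists 0; [exact: lspan0 | rewrite addr0].
apply: mem_root_sum lmxy; split=> //; rewrite ZAB => -[|//]; exact: nA.
Qed.

Let Z_neq0 l : Zset br P eta l -> l != 0. Proof. by case=> -[]. Qed.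

Lemma lie_gZdag_g1 :
  lie_set br (g_Zdag br P eta) g1 `<=` sum_set g1 (g_Z br P eta).
Proof.
apply: (lie_sum_set (A := Zdag P eta)) => [|l m Zl [Rm nZ] Rl _||l [[]] //];
  last exact: Zdag_neq0.
  exact: setUC.
split=> [|Rlm Zlm].
  apply/eqP => /eqP; rewrite addr_eq0 => /eqP lE; apply: nZ; left; split=> //.
  by rewrite -lE.
apply: (extended_simple_sub R0 PR RP PN PD Peta eta_max Zlm Zl (or_introl Rlm)).
by rewrite addrAC subrr add0r.
Qed.

Lemma lie_gZ_g1 :
  lie_set br (g_Z br P eta) g1 `<=` sum_set g1 (g_Zdag br P eta).
Proof.
apply: (lie_sum_set (A := Zset br P eta)) => [//|l m [_ Zl] [Rm nZ] Rl _||l [[]] //];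
  last exact: Z_neq0.
split=> [|Rlm [_ Zlm]].
  apply/eqP => /eqP; rewrite addrC addr_eq0 => /eqP mE; apply: nZ; right.
  by rewrite mE.
apply: (extended_simple_sub R0 PR RP PN PD Peta eta_max Zl Zlm).
  by right; rewrite opprK.
by rewrite opprK addKr.
Qed.

Lemma lie_gZ_gZ :
  lie_set br (g_Z br P eta) (g_Z br P eta) `<=` sum_set g1 (g_Zdag br P eta).
Proof.
apply: (lie_sum_set (A := Zset br P eta)) => [//|l m [_ Zl] [_ Zm] Rl Rm||l];
  try exact: Z_neq0.
split=> [|Rlm [_ Zlm]].
  rewrite -oppr_eq0 opprD.
  apply: (extended_simple_add_neq0 PN Peta eta_dec Zl Zm).
  by right; rewrite !opprK.
rewrite opprD in Zlm.
apply: (extended_simple_add R0 PR PN PD Peta eta_max Zl Zm _ Zlm).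
by right; rewrite -opprD !opprK.
Qed.

Lemma lie_gZdag_gZdag :
  lie_set br (g_Zdag br P eta) (g_Zdag br P eta) `<=` sum_set g1 (g_Z br P eta).
Proof.
apply: (lie_sum_set (A := Zdag P eta)) => [|l m Zl Zm Rl Rm||l];
  try exact: Zdag_neq0.
  exact: setUC.
split=> [|Rlm].
  by apply: (extended_simple_add_neq0 PN Peta eta_dec Zl Zm); left.
by apply: (extended_simple_add R0 PR PN PD Peta eta_max Zl Zm); left.
Qed.
End RootSpaces.
End Cartan.
End LieTheory.

Theorem proposition2p2p2 (R : realType) (g : vectType R[i])
    (br : {bilinear g -> g -> g}) (h : {vspace g})
    (P : set (dual h)) (eta : dual h)
    (Hlie : lie_bracket br) (Hsimple : simple_lie br)
    (Hcartan : cartan_subalgebra br h) (Hrank : (2 <= \dim h)%N)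
    (Hpos : positive_system br P) (Heta : longest_root br P eta) :
  let hh := [set` h] in
  let gZdag := g_Zdag br P eta in
  let gZ := g_Z br P eta in
  let g1 := g_1 br P eta in
  lie_set br hh gZdag `<=` gZdag /\
  lie_set br hh gZ `<=` gZ /\
  lie_set br hh g1 `<=` g1 /\
  lie_set br gZ gZdag `<=` hh /\
  lie_set br gZdag g1 `<=` sum_set g1 gZ /\
  lie_set br gZ g1 `<=` sum_set g1 gZdag /\
  lie_set br gZ gZ `<=` sum_set g1 gZdag /\
  lie_set br gZdag gZdag `<=` sum_set g1 gZ.
Proof.
move=> hh gZdag gZ g1.
split; first exact: lie_h_root_sum.
split; first exact: lie_h_root_sum.
split; first exact: lie_h_root_sum.
split; first exact: lie_gZ_gZdag.
split; first exact: lie_gZdag_g1.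
split; first exact: lie_gZ_g1.
split; first exact: lie_gZ_gZ.
exact: lie_gZdag_gZdag.
Qed.
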